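(* Let $f:[a,b]\to\mathbb{R}$ be left-continuous on $(a,b]$ and such that $f'_g(t)=0$ for all $t\in[a,b]$. Then $$f(t)=f(s)\quad\text{for all } s,t\in I,\quad I\in\mathcal{I}_1.$$
   Context: Let $a<b$ be real numbers and let $g:\mathbb{R}\to\mathbb{R}$ be non-decreasing and left-continuous (a ''derivator''). Put $\Delta g(t)=g(t^+)-g(t)$, $D_g=\{t\in\mathbb{R}:\Delta g(t)>0\}$, and $C_g=\{t\in\mathbb{R}: g \text{ is constant on } (t-\varepsilon,t+\varepsilon)\text{ for some }\varepsilon>0\}$. The set $C_g$ is open; write $C_g=\bigcup_n (a_n,b_n)$ with $(a_n,b_n)$ its (pairwise disjoint) connected components. Put $N_g^-=\{a_n\}_n\setminus D_g$, $N_g^+=\{b_n\}_n\setminus D_g$. Standing assumption: $a\notin N_g^-$ and $b\notin N_g^+\cup D_g\cup C_g$. $g$-derivative: for $f:[a,b]\to\mathbb{R}$ and $t\in[a,b]$, $f'_g(t)=\lim_{s\to t}\frac{f(s)-f(t)}{g(s)-g(t)}$ if $t\notin D_g\cup C_g$; $f'_g(t)=\lim_{s\to t^+}\frac{f(s)-f(t)}{g(s)-g(t)}$ if $t\in D_g$; $f'_g(t)=\lim_{s\to b_n^+}\frac{f(s)-f(b_n)}{g(s)-g(b_n)}$ if $t\in(a_n,b_n)\subset C_g$; provided the limit exists (and is finite). Limits are taken over those $s\in[a,b]$ for which the denominator is nonzero. $\mathcal{I}_1$ denotes the family of connected components of $[a,b]\setminus C_g$. *)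

(* Defs.v *)
From HB Require Import structures.
From mathcomp Require Export all_boot all_order all_algebra.
From mathcomp Require Export all_classical all_reals all_analysis.
Export Order.TTheory GRing.Theory Num.Theory.
Export numFieldNormedType.Exports.

Set Implicit Arguments.
Unset Strict Implicit.
Unset Printing Implicit Defensive.

Local Open Scope classical_set_scope.
Local Open Scope ring_scope.

Definition derivator (R : realType) (g : R -> R) : Prop :=
  {homo g : x y / x <= y} /\ forall t : R, g s @[s --> t^'-] --> g t.

Definition jump (R : realType) (g : R -> R) (t : R) : R :=
  lim (g s @[s --> t^'+]) - g t.

Definition Dset (R : realType) (g : R -> R) : set R :=
  [set t | 0 < jump g t].

Definition Cset (R : realType) (g : R -> R) : set R :=
  [set t | exists2 e : R, 0 < e &
    {in `]t - e, t + e[ &, forall x y, g x = g y}].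

(* The connected components of [Cset g] are the open intervals
   ]a_n, b_n[, possibly unbounded.  Since [infimums] and
   [supremums] range over R, only finite endpoints are collected. *)
Definition Nminus (R : realType) (g : R -> R) : set R :=
  [set x | exists2 t, Cset g t &
    infimums (connected_component (Cset g) t) x] `\` Dset g.

Definition Nplus (R : realType) (g : R -> R) : set R :=
  [set x | exists2 t, Cset g t &
    supremums (connected_component (Cset g) t) x] `\` Dset g.

Definition standing_assumption (R : realType) (a b : R) (g : R -> R) : Prop :=
  ~ Nminus g a /\ ~ (Nplus g `|` Dset g `|` Cset g) b.

(* [F] is the filter along which s tends to t (two-sided or right). *)
Definition gquot_cvg (R : realType) (a b : R) (g f : R -> R) (t : R)
    (F : set_system R) (l : R) : Prop :=
  (f s - f t) / (g s - g t)
    @[s --> within [set s | s \in `[a, b] /\ g s - g t != 0] F] --> l.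

(* "The g-derivative of f : [a, b] -> R at t exists and equals l".  Only the
   values of f on [a, b] matter when t, and for t in Cset g the right endpoint
   of its component, lie in [a, b].  For a derivator g under
   [standing_assumption] and t in [a, b] the filters below are proper, so l is
   unique. *)
Definition has_gderiv (R : realType) (a b : R) (g f : R -> R) (t l : R) :
    Prop :=
  [\/ ~ (Dset g `|` Cset g) t /\ gquot_cvg a b g f t (nbhs t) l,
      Dset g t /\ gquot_cvg a b g f t t^'+ l
    | Cset g t /\ exists2 bn : R,
        supremums (connected_component (Cset g) t) bn &
        gquot_cvg a b g f bn bn^'+ l].

Definition I1 (R : realType) (a b : R) (g : R -> R) : set (set R) :=
  connected_component (`[a, b] `\` Cset g) @` (`[a, b] `\` Cset g).

(* Main.v *)
Require Import Defs.
From mathcomp Require Import lra.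
Local Open Scope classical_set_scope.
Local Open Scope ring_scope.

(** Two points s < t of a connected component I of [a, b] \ C_g span a segment
    that misses C_g, and there g is strictly increasing
    ([increasing_off_Cset]): were g to take the same value at two points,
    it would be constant around their midpoint.  Hence every difference quotient
    based at a point x of [s, t[ is defined just to the right of x, and
    f'_g(x) = 0 gives, for each e > 0,
    |f y - f x| <= e (g y - g x) for y slightly greater than x
    ([gderiv0_right_bound]).  So the function
    h y = |f y - f s| - e (g y - g s) does not exceed h x just to the right of
    x; being also left-continuous, it satisfies h t <= h s = 0 by a supremum
    argument ([left_cont_creep]).  Letting e tend to 0 yields f t = f s.

    Left-continuity can replace the continuity of the usual mean value
    inequality because f and g can jump only to the right of a point, which is
    where the derivative controls f in terms of g. *)

(** The points x of [c, d] with h x <= h c have a supremum m; left-continuity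
    puts m among them, and the local hypothesis at m would push past m
    if m < d. *)
Lemma left_cont_creep (R : realType) (c d : R) (h : R -> R) :
  c <= d ->
  (forall x, x \in `]c, d] -> h y @[y --> x^'-] --> h x) ->
  (forall x, x \in `[c, d[ -> \forall y \near x^'+, h y <= h x) ->
  h d <= h c.
Proof.
move=> cd hleft hright.
pose S := [set x | x \in `[c, d] /\ h x <= h c].
have Sc : S c by split; rewrite //= in_itv /= lexx.
have ubSd : ubound S d by move=> x [/= + _]; rewrite in_itv /= => /andP[].
have supS : has_sup S by split; [exists c | exists d].
have cm : c <= sup S by apply: ub_le_sup => //; exists d.
have md : sup S <= d by apply: ge_sup => //; exists c.
have Sm : h (sup S) <= h c.
  rewrite leNgt; apply/negP => hcm.
  have {}cm : c < sup S.
    by rewrite lt_neqAle cm andbT; apply: contraTneq hcm => <-; rewrite ltxx.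
  have mcd : sup S \in `]c, d] by rewrite in_itv /= cm md.
  have := hleft _ mcd => /cvgr_gt /(_ _ hcm).
  case/nbhs_ballP => e /= e0 he.
  have [x [xcd hx] mex] := sup_adherent e0 supS.
  have xm : x <= sup S by apply: ub_le_sup => //; exists d.
  move: xm; rewrite le_eqVlt => /predU1P[xm|xm].
    by move: hx; rewrite leNgt xm hcm.
  suff : h c < h x by rewrite ltNge hx.
  by apply: he => //; rewrite /ball /= ger0_norm ?subr_ge0 ?ltW//; lra.
move: md; rewrite le_eqVlt => /predU1P[<-//|md].
have mcd : sup S \in `[c, d[ by rewrite in_itv /= cm md.
have [y [my yd hy]] : exists y, [/\ sup S < y, y <= d & h y <= h (sup S)].
  have := hright _ mcd => hm.
  have /filter_ex[y [[my yd] hy]] : \forall y \near (sup S)^'+,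
      (sup S < y /\ y <= d) /\ h y <= h (sup S).
    apply: filterI => //; apply: filterI; first exact: nbhs_right_gt.
    exact: nbhs_right_le.
  by exists y.
suff : y <= sup S by rewrite leNgt my.
apply: ub_le_sup; first by exists d.
by split; [rewrite in_itv /= yd (le_trans cm (ltW my)) | exact: le_trans Sm].
Qed.

Lemma increasing_off_Cset (R : realType) (c d : R) (g : R -> R) :
  {homo g : x y / x <= y} -> `[c, d] `<=` ~` Cset g ->
  {in `[c, d] &, {homo g : x y / x < y}}.
Proof.
move=> gmon offC x y; rewrite !in_itv /= => /andP[cx xd] /andP[cy yd] xy.
rewrite lt_neqAle gmon ?ltW// andbT; apply/negP => /eqP gxy.
apply: (offC ((x + y) / 2)); first by rewrite /= in_itv /=; lra.
exists ((y - x) / 2) => [|u v]; first lra.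
rewrite !in_itv /= => /andP[u1 u2] /andP[v1 v2].
have const w : x <= w -> w <= y -> g w = g x.
  move=> xw wy; apply/eqP; rewrite eq_le (gmon _ _ xw) andbT gxy.
  exact: gmon.
by rewrite !const//; lra.
Qed.

(** Off C_g the derivative is a two-sided limit or, where g jumps, a limit from
    the right; the former implies the latter, so both cases give the same
    bound. *)
Lemma gderiv0_right_bound (R : realType) (a b : R) (g f : R -> R) (t e : R) :
  0 < e -> ~ Cset g t -> has_gderiv a b g f t 0 ->
  \forall y \near t^'+, y \in `[a, b] -> g y - g t != 0 ->
    `|f y - f t| <= e * `|g y - g t|.
Proof.
move=> e0 NCt df.
have {df} : gquot_cvg a b g f t t^'+ 0.
  case: df => [[_ cvt]|[_ //]|[]//].
  apply: cvg_trans cvt; apply: cvg_app => A.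
  by rewrite /nbhs /= /within /=; apply: filterS => y Ay _.
move=> /cvgr0_norm_le /(_ _ e0); rewrite near_withinE.
apply: filterS => y /= + yab gy => /(_ (conj yab gy)).
by rewrite normrM normfV ler_pdivrMr ?normr_gt0.
Qed.

Theorem corollary3p13 (R : realType) (a b : R) (g : R -> R) (f : R -> R)
  (ltab : a < b)
  (hg : derivator g)
  (hab : standing_assumption a b g)
  (f_left_cont : forall t : R, t \in `]a, b] -> f s @[s --> t^'-] --> f t)
  (f_gderiv0 : forall t : R, t \in `[a, b] -> has_gderiv a b g f t 0) :
  forall I : set R, I1 a b g I -> forall s t : R, I s -> I t -> f t = f s.
Proof.
case: hg => gmon gleft I [p pab <-] s t.
wlog st : s t / s <= t.
  move=> wlog_st Is It; have [st|/ltW ts] := leP s t; first exact: wlog_st.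
  by apply/esym; exact: wlog_st.
move=> Is It.
have stab : `[s, t] `<=` `[a, b] `\` Cset g.
  apply: subset_trans (@connected_component_sub _ _ p) => x.
  rewrite /= in_itv /=.
  have /connected_intervalP itvI := @component_connected _ (`[a, b] `\` Cset g) p.
  exact: itvI.
have ginc := increasing_off_Cset _ _ _ _ gmon (fun x xst => (stab x xst).2).
have bound e : 0 < e -> `|f t - f s| <= e * (g t - g s).
  move=> e0; pose h y := `|f y - f s| - e * (g y - g s).
  suff : h t <= h s by rewrite /h !subrr normr0 mulr0 subr0 subr_le0.
  apply: left_cont_creep => // x xst.
    have xab : x \in `]a, b].
      have [sab _] := stab s ltac:(by rewrite /= in_itv /= lexx).
      have [xab _] := stab x (subset_itv_oc_cc xst).
      move: xst sab xab; rewrite /= !in_itv /= => /andP[sx _] /andP[a_s _].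
      by case/andP => _ ->; rewrite (le_lt_trans a_s sx).
    apply: cvgB.
      by apply: cvg_norm; apply: cvgB (f_left_cont _ xab) _; exact: cvg_cst.
    by apply: cvgMr; apply: cvgB (gleft x) _; exact: cvg_cst.
  have xcc : x \in `[s, t] by exact: subset_itv_co_cc xst.
  have [xab NCx] := stab x xcc.
  have near_x := gderiv0_right_bound _ _ _ _ _ _ _ e0 NCx (f_gderiv0 _ xab).
  have xt : x < t by move: xst; rewrite in_itv => /andP[].
  near=> y.
  have xy : x < y by near: y; exact: nbhs_right_gt.
  have yst : y \in `[s, t].
    move: xcc; rewrite !in_itv /= => /andP[sx _].
    rewrite (le_trans sx (ltW xy)) /=.
    by near: y; exact: nbhs_right_le.
  have gxy : 0 < g y - g x by rewrite subr_gt0 ginc.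
  have [yab _] := stab y yst.
  have fxy : `|f y - f x| <= e * (g y - g x).
    rewrite -(gtr0_norm gxy).
    have : g y - g x != 0 by rewrite gt_eqF.
    by move: yab; near: y.
  have := ler_distD (f x) (f y) (f s).
  by rewrite /h; nra.
apply/eqP; rewrite -subr_eq0 -normr_le0; apply/ler_addgt0Pl => e e0.
have gst : 0 <= g t - g s by rewrite subr_ge0 gmon.
(* The bound is used at e / (g t - g s + 1): the 1 keeps the divisor positive
   when s = t. *)
have k0 : 0 < g t - g s + 1 by lra.
rewrite addr0; apply: le_trans (bound _ (divr_gt0 e0 k0)) _.
by rewrite mulrAC ler_pdivrMr//; nra.
Unshelve. all: by end_near.
Qed.
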